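(* Let $k\ge 2$ be an integer, $m$ a positive integer and $\vec b=(b_0,b_1,b_2,\dots)$ a sequence of integers. Suppose there exists a positive integer $s$ such that each of the weights $b_s,b_{s+1},\dots,b_{s+k-2}$ is divisible by $m$. Then the sequence $C^{\vec b}_{k,1},C^{\vec b}_{k,2},\dots$ of $k$-dimensional weighted Catalan numbers is eventually periodic modulo $m$; that is, there exist positive integers $N$ and $t$ such that $C^{\vec b}_{k,n+t}\equiv C^{\vec b}_{k,n}\pmod m$ for all $n\ge N$.
   Context: A $k$-dimensional Balanced ballot path of $kn$ steps is a lattice path in $\mathbb{Z}^k$ from $(0,\dots,0)$ to $(n,\dots,n)$ with $kn$ steps, each step being one of the standard unit vectors $\vec e_1,\dots,\vec e_k$, such that every point $x=(x_1,\dots,x_k)$ on the path satisfies $x_1\ge x_2\ge\cdots\ge x_k$. An up-step is a step $\vec e_1$. The height of a point $x\in\mathbb{Z}^k$ is $h_k(x)=(k-1)x_1-\sum_{i=2}^k x_i$. The weight of such a path $P$ with respect to $\vec b$ is $wt_{\vec b}(P)=b_{h_1}b_{h_2}\cdots b_{h_n}$, where $h_i$ is the height of the starting point of the $i$-th up-step of $P$. The $n$-th $k$-dimensional weighted Catalan number is $C^{\vec b}_{k,n}=\sum_P wt_{\vec b}(P)$, the sum over all $k$-dimensional Balanced ballot paths $P$ of $kn$ steps. *)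

(* Defs.v *)
From mathcomp Require Import all_boot all_order all_algebra.

Set Implicit Arguments.
Unset Strict Implicit.
Unset Printing Implicit Defensive.

Import Order.TTheory GRing.Theory Num.Theory.
Local Open Scope ring_scope.

(* Coordinates are indexed from 0: the ordinal i : 'I_k stands for the
   (i+1)-st coordinate or step, so x_1 is the coordinate of index 0 and an
   up-step is the step of index 0. A lattice path starting at the origin is
   given by its sequence of steps. *)

Definition path_point (k : nat) (w : seq 'I_k) (j : nat) : 'rV[int]_k :=
  \sum_(e <- take j w) delta_mx 0 e.

(* The first sum has the single term x_1 when 0 < k; this form avoids
   requiring k to be syntactically a successor. *)
Definition height (k : nat) (x : 'rV[int]_k) : int :=
  (k%:Z - 1) * (\sum_(i < k | i == 0 :> nat) x 0 i)
  - \sum_(i < k | (0 < i)%N) x 0 i.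

Definition ballot_point (k : nat) (x : 'rV[int]_k) : bool :=
  [forall i : 'I_k, forall j : 'I_k, (i <= j)%N ==> (x 0 j <= x 0 i)].

Lemma ballot_height_ge0 (k : nat) (x : 'rV[int]_k) : ballot_point x -> 0 <= height x.
Proof.
case: k x => [|k] x; first by rewrite /height !big_ord0 mulr0 subr0.
move=> /forallP/(_ ord0)/forallP H; rewrite /height.
rewrite (big_pred1 ord0) //; rewrite (big_mkcond (fun i : 'I_ _ => (0 < i)%N)) big_ord_recl /= add0r.
rewrite subr_ge0; apply: (@le_trans _ _ (\sum_(i < k) x 0 ord0)).
  by apply: ler_sum => i _; have := H (lift ord0 i); rewrite leq0n.
by rewrite sumr_const card_ord -mulr_natl; rewrite intS [1 + _]addrC addrK natz.
Qed.

Definition balanced_ballot_path (k n : nat) (w : (k * n).-tuple 'I_k) : bool :=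
  (path_point w (k * n) == const_mx n%:Z) &&
  [forall j : 'I_(k * n).+1, ballot_point (path_point w j)].

(* The absolute value only serves to index b by a natural number: see
   ballot_height_ge0. *)
Definition path_weight (b : nat -> int) (k n : nat)
    (w : (k * n).-tuple 'I_k) : int :=
  \prod_(j < k * n | tnth w j == 0 :> nat) b `|height (path_point w j)|%N.

Definition weighted_catalan (b : nat -> int) (k n : nat) : int :=
  \sum_(w : (k * n).-tuple 'I_k | balanced_ballot_path w) path_weight b w.

(* Main.v *)
Require Import Defs.
From mathcomp Require Import all_boot all_order all_algebra.
From mathcomp Require Import zify.

(** A path whose weight is nonzero modulo m never takes an up-step from a height
    in the window s, ..., s+k-2.  An up-step raises the height by k-1, exactly
    the length of the window, and every other step lowers it by 1; so such a
    path, which starts at height 0 < s, cannot jump over the window and stays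
    below height s+k-1.  For a ballot point the height is the sum of the
    nonnegative gaps x_1 - x_i, so a bounded height leaves finitely many points
    up to translation along the diagonal (1,...,1).

    This makes the counting a finite-state process.  Let [walk_sum b r x] be the
    total weight of the ballot walks of r steps from x to the diagonal; it is
    invariant under diagonal translations ([walk_sum_translate]), and first-step
    decomposition ([walk_sumS]) expresses [walk_sum b r.+1] through
    [walk_sum b r].  Modulo m, the values at the points of height below s+k-1
    determine the next values at these same points ([low_congr_step]): from
    inside the window the only step that would leave this region carries a
    weight divisible by m.  There are finitely many tables of residues on the
    region, so two of them coincide ([low_congr_pigeonhole]) and the tables
    repeat from then on ([low_congr_periodic]).  Finally C_n is the entry of
    the table of index kn at the origin ([weighted_catalan_walk_sum]), and a
    period t of the tables gives kn + kt = k(n+t).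

    Throughout, the dimension is written k.+1, so the window is
    s, ..., s+k-1. *)

Set Implicit Arguments.
Unset Strict Implicit.
Unset Printing Implicit Defensive.

Import Order.TTheory GRing.Theory Num.Theory.
Local Open Scope ring_scope.

(** * Heights and ballot points *)

Lemma heightE k (x : 'rV[int]_k.+1) :
  height x = \sum_(i < k.+1) (x 0 0 - x 0 i).
Proof.
rewrite /height (big_pred1 ord0) // big_mkcond /= !big_ord_recl /= subrr !add0r.
by rewrite sumrB sumr_const card_ord -mulr_natl intS [1 + _]addrC addrK natz.
Qed.

Lemma height_translate k (x : 'rV[int]_k.+1) c :
  height (x + const_mx c) = height x.
Proof.
rewrite !heightE; apply: eq_bigr => i _.
by rewrite !mxE opprD addrACA subrr addr0.
Qed.

Lemma ballot_point_translate k (x : 'rV[int]_k.+1) c :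
  ballot_point (x + const_mx c) = ballot_point x.
Proof.
by apply: eq_forallb => i; apply: eq_forallb => j; rewrite !mxE lerD2r.
Qed.

Lemma height_step k (x : 'rV[int]_k.+1) (e : 'I_k.+1) :
  height (x + delta_mx 0 e) =
  height x + (if e == 0 :> nat then k.+1%:Z else 0) - 1.
Proof.
have -> : (if e == 0 :> nat then k.+1%:Z else 0) =
    \sum_(i < k.+1) (e == 0 :> nat)%:R.
  by rewrite sumr_const card_ord; case: (_ == _); rewrite /= ?natz ?mul0rn.
have one_sum : 1%R = \sum_(i < k.+1) (i == e)%:R :> int.
  by rewrite (bigD1 e) //= eqxx big1 ?addr0 // => i /negbTE ->.
rewrite !heightE [X in _ - X]one_sum -big_split -sumrB; apply: eq_bigr => i _ /=.
rewrite !mxE eqxx /= [0 == e]eq_sym -(inj_eq val_inj e) /=.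
by rewrite opprD [_ + _ + (_ - _)]addrACA !addrA.
Qed.

Lemma ballot_gap_ge0 k (x : 'rV[int]_k.+1) i :
  ballot_point x -> 0 <= x 0 0 - x 0 i.
Proof. by move=> /forallP/(_ 0)/forallP/(_ i); rewrite subr_ge0. Qed.

(** The gaps of a ballot point are nonnegative, so none exceeds their sum. *)
Lemma ballot_gap_le_height k (x : 'rV[int]_k.+1) i :
  ballot_point x -> x 0 0 - x 0 i <= height x.
Proof.
move=> bx; rewrite heightE (bigD1 i) //= lerDl.
by apply: sumr_ge0 => j _; apply: ballot_gap_ge0.
Qed.

(** * Weighted ballot walks from an arbitrary point to the diagonal *)

Definition diagonal_point k (x : 'rV[int]_k.+1) : bool := x == const_mx (x 0 0).

Lemma diagonal_point_translate k (x : 'rV[int]_k.+1) c :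
  diagonal_point (x + const_mx c) = diagonal_point x.
Proof.
rewrite /diagonal_point; have -> : (x + const_mx c) 0 0 = x 0 0 + c.
  by rewrite !mxE.
by rewrite raddfD (inj_eq (addIr _)).
Qed.

Definition ballot_walk k r (x : 'rV[int]_k.+1) (w : r.-tuple 'I_k.+1) : bool :=
  diagonal_point (x + path_point w r) &&
  [forall j : 'I_r.+1, ballot_point (x + path_point w j)].

Definition step_weight (b : nat -> int) k (x : 'rV[int]_k.+1) (e : 'I_k.+1) :
  int := if e == 0 :> nat then b `|height x|%N else 1.

Definition walk_weight (b : nat -> int) k r (x : 'rV[int]_k.+1)
    (w : r.-tuple 'I_k.+1) : int :=
  \prod_(j < r) step_weight b (x + path_point w j) (tnth w j).

Definition walk_sum (b : nat -> int) k r (x : 'rV[int]_k.+1) : int :=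
  \sum_(w : r.-tuple 'I_k.+1 | ballot_walk x w) walk_weight b x w.

Lemma path_point0 k (w : seq 'I_k) : path_point w 0 = 0.
Proof. by rewrite /path_point take0 big_nil. Qed.

Lemma path_pointS k e (w : seq 'I_k) j :
  path_point (e :: w) j.+1 = delta_mx 0 e + path_point w j.
Proof. by rewrite /path_point /= big_cons. Qed.

Lemma ballot_walk_cons k r (x : 'rV[int]_k.+1) e (w : r.-tuple 'I_k.+1) :
  ballot_walk x [tuple of e :: w] =
  ballot_point x && ballot_walk (x + delta_mx 0 e) w.
Proof.
rewrite /ballot_walk /= path_pointS addrA andbCA; congr (_ && _).
apply/forallP/andP => [H | [bx /forallP H] j].
  split; first by have := H ord0; rewrite path_point0 addr0.
  by apply/forallP => j; have := H (lift ord0 j); rewrite path_pointS addrA.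
case: (unliftP ord0 j) => [i|] ->; last by rewrite path_point0 addr0.
by rewrite path_pointS addrA.
Qed.

Lemma walk_weight_cons b k r (x : 'rV[int]_k.+1) e (w : r.-tuple 'I_k.+1) :
  walk_weight b x [tuple of e :: w] =
  step_weight b x e * walk_weight b (x + delta_mx 0 e) w.
Proof.
rewrite /walk_weight big_ord_recl path_point0 addr0 tnth0; congr (_ * _).
by apply: eq_bigr => j _; rewrite tnthS path_pointS addrA.
Qed.

(** First-step decomposition.  Points off the ballot region are admitted, with
    value 0, so the sum runs over all steps, even those leaving the region. *)
Lemma walk_sumS b k r (x : 'rV[int]_k.+1) :
  walk_sum b r.+1 x =
  if ballot_point x then
    \sum_(e < k.+1) step_weight b x e * walk_sum b r (x + delta_mx 0 e)
  else 0.
Proof.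
rewrite /walk_sum (reindex (fun p : 'I_k.+1 * r.-tuple 'I_k.+1 =>
  [tuple of p.1 :: p.2])) /=; last first.
  exists (fun t => (thead t, [tuple of behead t])) => [[e w] _ | t _] /=.
    by congr (_, _); apply: val_inj.
  by rewrite [RHS]tuple_eta.
under eq_bigl => p do rewrite ballot_walk_cons.
case: (ballot_point x); last by rewrite big_pred0.
under eq_bigr => p _ do rewrite walk_weight_cons.
rewrite -(pair_big_dep xpredT (fun e w => ballot_walk (x + delta_mx 0 e) w)
  (fun e w => step_weight b x e * walk_weight b (x + delta_mx 0 e) w)) /=.
by apply: eq_bigr => e _; rewrite big_distrr.
Qed.

Lemma walk_sum_translate b k r (x : 'rV[int]_k.+1) c :
  walk_sum b r (x + const_mx c) = walk_sum b r x.
Proof.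
apply: eq_big => w.
  rewrite /ballot_walk addrAC; congr (_ && _).
    exact: diagonal_point_translate.
  by apply: eq_forallb => j; rewrite addrAC ballot_point_translate.
move=> _; apply: eq_bigr => j _.
by rewrite /step_weight addrAC height_translate.
Qed.

Lemma sum_path_point k (w : seq 'I_k) :
  \sum_i path_point w (size w) 0 i = (size w)%:Z.
Proof.
elim: w => [|e w IHw] /=.
  by rewrite path_point0 big1 // => i _; rewrite mxE.
rewrite path_pointS intS -{}IHw; under eq_bigr do rewrite mxE.
rewrite big_split /= (bigD1 e) //= mxE !eqxx big1 ?addr0 // => i /negbTE ne.
by rewrite mxE ne.
Qed.

(** The coordinates of the endpoint add up to the number of steps, so a walk of
    (k+1)n steps from the origin that ends on the diagonal ends at
    (n,...,n). *)
Lemma weighted_catalan_walk_sum b k n :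
  weighted_catalan b k.+1 n = walk_sum b (k.+1 * n) (0 : 'rV_k.+1).
Proof.
apply: eq_big => w.
  rewrite /balanced_ballot_path /ballot_walk add0r; congr (_ && _).
    rewrite /diagonal_point; apply/eqP/eqP => [-> | eq_diag].
      by rewrite mxE.
    have := sum_path_point w; rewrite size_tuple eq_diag.
    under eq_bigr do rewrite mxE.
    rewrite sumr_const card_ord -mulr_natl PoszM natz => /mulfI -> //.
  by apply: eq_forallb => j; rewrite add0r.
move=> _; rewrite /path_weight big_mkcond /=; apply: eq_bigr => j _.
by rewrite /step_weight add0r.
Qed.

(** * Residues at points of bounded height *)

(** Agreement of the tables of residues of lengths r and r'.  Bounding the height
    makes the tables finite up to diagonal translations, and for a suitable h
    they still determine the next ones, modulo m. *)
Definition low_congr (b : nat -> int) (m k h r r' : nat) : Prop :=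
  forall x : 'rV[int]_k.+1, ballot_point x -> height x < h%:Z ->
  (walk_sum b r x = walk_sum b r' x %[mod m])%Z.

(** From a height below s an up-step lands below s+k; from a height in
    s, ..., s+k-1 it has weight 0 modulo m; any other step goes down. *)
Lemma low_congr_step b m k s r r' :
  (forall i, (s <= i < s + k)%N -> (m%:Z %| b i)%Z) ->
  low_congr b m k (s + k) r r' -> low_congr b m k (s + k) r.+1 r'.+1.
Proof.
move=> hb Hr x bx hx; apply/eqP.
rewrite eqz_mod_dvd !walk_sumS bx -sumrB; apply: rpred_sum => e _.
rewrite -mulrBr; have h0 := ballot_height_ge0 bx.
have [/andP[e0 hs] | out] := boolP ((e == 0 :> nat) && (s%:Z <= height x)).
  apply: dvdz_mulr; rewrite /step_weight e0; apply: hb; lia.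
apply: dvdz_mull; rewrite -eqz_mod_dvd; apply/eqP.
have [by' | nby] := boolP (ballot_point (x + delta_mx 0 e)); last first.
  (* no ballot walk starts outside the ballot region *)
  suff walk0 q : walk_sum b q (x + delta_mx 0 e) = 0 by rewrite !walk0.
  apply: big_pred0 => w; apply: contraNF nby => /andP[_ /forallP/(_ ord0)].
  by rewrite path_point0 addr0.
apply: Hr => //; rewrite height_step.
by move: out; case: ifP => _ /=; lia.
Qed.

Lemma finite_sequence_repeats (T : finType) (g : nat -> T) :
  exists i j : nat, (i < j)%N /\ g i = g j.
Proof.
pose f (i : 'I_#|T|.+1) := g i.
have /injectivePn[i [j ne_ij eq_f]] : ~~ injectiveb f.
  apply/negP => /injectiveP/leq_card.
  by rewrite card_ord ltnn.
have [lt_ij | lt_ji | /val_inj eq_ij] := ltngtP i j.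
- by exists i, j.
- by exists j, i.
- by rewrite eq_ij eqxx in ne_ij.
Qed.

(** A ballot point of height less than h is, up to a diagonal translation, the
    opposite of its vector of gaps, whose entries are natural numbers less than
    h; hence finitely many residues decide [low_congr]. *)
Lemma low_congr_pigeonhole b m k h : (0 < m)%N ->
  exists r r' : nat, (r < r')%N /\ low_congr b m k h r r'.
Proof.
case: m => // m _.
pose base (d : {ffun 'I_k.+1 -> 'I_h}) : 'rV[int]_k.+1 :=
  \row_i - (d i : nat)%:Z.
pose res r := [ffun d => inord `|(walk_sum b r (base d) %% m.+1)%Z|%N : 'I_m.+1].
have [r [r' [lt_rr' eq_res]]] := finite_sequence_repeats res.
exists r, r'; split=> // x bx hx.
have gap_lt i : (`|(x 0 0 - x 0 i)%R| < h)%N.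
  have := ballot_gap_ge0 i bx; have := ballot_gap_le_height i bx; lia.
pose d := [ffun i => Ordinal (gap_lt i)].
have -> : x = base d + const_mx (x 0 0).
  apply/rowP => i; rewrite !mxE ffunE /=.
  have := ballot_gap_ge0 i bx; lia.
rewrite !walk_sum_translate.
have := congr1 (fun f : {ffun _ -> _} => val (f d)) eq_res.
rewrite !ffunE /= !inordK; try lia.
Qed.

Lemma low_congr_periodic b m k s : (0 < m)%N ->
  (forall i, (s <= i < s + k)%N -> (m%:Z %| b i)%Z) ->
  exists r0 t : nat, (0 < t)%N /\
    forall r q : nat, (r0 <= r)%N -> low_congr b m k (s + k) (r + q * t) r.
Proof.
move=> m_gt0 hb; have [r0 [r1 [lt_r H01]]] := low_congr_pigeonhole b k (s + k) m_gt0.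
exists r0, (r1 - r0)%N; split; first by rewrite subn_gt0.
have period r : (r0 <= r)%N -> low_congr b m k (s + k) r (r + (r1 - r0)).
  move=> /subnK <-; elim: (r - r0)%N => [|i IHi].
    by rewrite add0n subnKC // ltnW.
  by rewrite !addSn; apply: low_congr_step.
move=> r q le_r; elim: q => [|q IHq] x bx hx; first by rewrite mul0n addn0.
rewrite mulSn addnCA addnC -(IHq x bx hx); apply/esym/period => //.
exact: leq_trans (leq_addr _ _).
Qed.

(** * Eventual periodicity *)

Theorem theorem3p5 (k m : nat) (b : nat -> int)
    (hk : (2 <= k)%N) (hm : (0 < m)%N)
    (hb : exists s : nat, (0 < s)%N /\
       forall i : nat, (s <= i <= s + k - 2)%N -> (m%:Z %| b i)%Z) :
  exists N t : nat, [/\ (0 < N)%N, (0 < t)%N &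
    forall n : nat, (N <= n)%N ->
      (weighted_catalan b k (n + t)%N = weighted_catalan b k n %[mod m%:Z])%Z].
Proof.
case: k hk hb => // k k_gt0 [s [s_gt0 hb]].
have window i : (s <= i < s + k)%N -> (m%:Z %| b i)%Z.
  by move=> hi; apply: hb; lia.
have [r0 [t [t_gt0 H]]] := low_congr_periodic hm window.
exists r0.+1, t; split=> // n le_n.
rewrite !weighted_catalan_walk_sum mulnDr; apply: H.
- by apply: leq_trans (ltnW le_n) _; rewrite leq_pmull.
- by apply/forallP => i; apply/forallP => j; rewrite !mxE lexx implybT.
- rewrite heightE big1 => [|i _]; last by rewrite !mxE subrr.
  by rewrite ltz_nat addn_gt0 s_gt0.
Qed.
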